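(* Let $A$ be an $n$-dimensional commutative algebra over a field $\mathbb{K}$, fix a basis of $A$, and let $J$ be the corresponding evolution test ideal of $A$. Then $A$ is an evolution algebra if and only if $V(J)\neq\emptyset$.
   Context: Algebras are not assumed associative or unital. A $\mathbb{K}$-algebra $A$ is an evolution algebra if it has a basis $\{u_i\}$ (called a natural basis) with $u_iu_j=0$ for all $i\neq j$. Evolution test ideal: let $A$ be a commutative $\mathbb{K}$-algebra of dimension $n$ with a fixed basis $\{e_k\}_{k=1}^n$. Write the product as $xy=\sum_{k=1}^n\langle x,y\rangle_k e_k$, where each $\langle\cdot,\cdot\rangle_k\colon A\times A\to\mathbb{K}$ is a symmetric bilinear form, and let $M_k$ be the Gram matrix of $\langle\cdot,\cdot\rangle_k$ in a basis of $A$ (the same basis for all $k$). Let $R=\mathbb{K}[\{z\}\sqcup\{x_{ij}\}_{i,j=1}^n]$ be the polynomial algebra in $n^2+1$ indeterminates. The evolution test ideal $J$ is the ideal of $R$ generated by the polynomial $p_0=1-z\det[(x_{ij})_{i,j=1}^n]$ and the polynomials $p_{ijk}=(x_{i1},\ldots,x_{in})\,M_k\,(x_{j1},\ldots,x_{jn})^t$ for $i,j,k\in\{1,\ldots,n\}$, $i\neq j$. For an ideal $H$ of $\mathbb{K}[x_1,\ldots,x_m]$, $V(H)=\{x\in\mathbb{K}^m: q(x)=0\ \forall q\in H\}$ is its set of zeros with coordinates in $\mathbb{K}$ itself. *)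

(* Defs.v *)
From HB Require Import structures.
From mathcomp Require Import all_boot all_order all_algebra.
From mathcomp Require Export mpoly.

Set Implicit Arguments.
Unset Strict Implicit.
Unset Printing Implicit Defensive.

Import GRing.Theory.
Local Open Scope ring_scope.

(* An algebra, not assumed associative or unital, is a vector space A together
   with a bilinear product mul. *)

Definition natural_basis (K : fieldType) (A : vectType K)
    (mul : {bilinear A -> A -> A}) (u : seq A) : Prop :=
  basis_of {:A} u /\ forall i j : 'I_(size u), i != j -> mul u`_i u`_j = 0.

Definition evolution_algebra (K : fieldType) (A : vectType K)
    (mul : {bilinear A -> A -> A}) : Prop :=
  exists u : seq A, natural_basis mul u.

(* mathcomp's idealr_closed only covers decidable ideals ({pred R}); an ideal
   given by generators is a Prop-valued predicate. *)
Definition is_ideal (R : comNzRingType) (I : R -> Prop) : Prop :=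
  [/\ I 0,
      forall x y, I x -> I y -> I (x + y)
    & forall a x, I x -> I (a * x)].

Definition ideal_generated (R : comNzRingType) (S : R -> Prop) : R -> Prop :=
  fun q => forall I, is_ideal I -> (forall s, S s -> I s) -> I q.

Definition zero_set (K : fieldType) (m : nat) (H : {mpoly K[m]} -> Prop)
    : ('I_m -> K) -> Prop :=
  fun x => forall q, H q -> q.@[x] = 0.

Definition coord_form (K : fieldType) (A : vectType K) (n : nat)
    (mul : A -> A -> A) (e : n.-tuple A) (k : 'I_n) (x y : A) : K :=
  coord e k (mul x y).

Definition gram_matrix (K : fieldType) (A : vectType K) (n : nat)
    (form : A -> A -> K) (b : n.-tuple A) : 'M[K]_n :=
  \matrix_(i, j) form b`_i b`_j.

Section EvolutionTestIdeal.

Variables (K : fieldType) (A : vectType K) (n : nat).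
Variables (mul : A -> A -> A) (e b : n.-tuple A).

(* The indeterminates are indexed by 'I_(1 + n * n): index 0 is z, and
   1 + mxvec_index i j is x_ij. *)
Local Notation R := {mpoly K[1 + n * n]}.

Definition z_var : R := 'X_(lshift (n * n) ord0).

Definition x_mx : 'M[R]_n := \matrix_(i, j) 'X_(rshift 1 (mxvec_index i j)).

Definition p0 : R := 1 - z_var * \det x_mx.

Definition p_ijk (i j k : 'I_n) : R :=
  (row i x_mx *m map_mx (@mpolyC (1 + n * n) K)
     (gram_matrix (coord_form mul e k) b) *m (row j x_mx)^T) 0 0.

Definition test_generator (q : R) : Prop :=
  q = p0 \/ exists i j k : 'I_n, i != j /\ q = p_ijk i j k.

(* e is the basis defining the forms <.,.>_k, b the basis in which their Gram
   matrices are taken; b = e is allowed but not imposed. *)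
Definition evolution_test_ideal : R -> Prop := ideal_generated test_generator.

End EvolutionTestIdeal.

(* Main.v *)
(** Reading a point of K^(1 + n^2) as a scalar z and an n x n matrix X, the rows of X are the
    coordinates in b of vectors u_1, ..., u_n. The polynomial p_ijk evaluates to the k-th coordinate
    of u_i u_j, and p_0 vanishes for some z exactly when det X is nonzero, i.e. when the u_i form a
    basis. *)
Require Import Defs.
From mathcomp Require Import all_boot all_order all_algebra.

Local Open Scope ring_scope.

Set Implicit Arguments.
Unset Strict Implicit.
Unset Printing Implicit Defensive.

Import GRing.Theory.

(** The polynomials vanishing at [x] form an ideal, so they contain the ideal generated by [S] once
    they contain [S]. *)
Lemma zero_set_generated (K : fieldType) (m : nat) (S : {mpoly K[m]} -> Prop)
    (x : 'I_m -> K) :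
  zero_set (ideal_generated S) x <-> forall s, S s -> s.@[x] = 0.
Proof.
split=> [x0 s Ss|S0 q]; first by apply: x0 => I _; apply.
move/(_ (fun q => q.@[x] = 0)); apply; last exact: S0.
split=> [|p r p0 r0|a p p0]; first by rewrite meval0.
  by rewrite mevalD p0 r0 addr0.
by rewrite mevalM p0 mulr0.
Qed.

Section RowCombination.
Variables (K : fieldType) (A : vectType K) (n : nat) (b : n.-tuple A).

Definition row_comb (X : 'M[K]_n) : n.-tuple A :=
  [tuple \sum_j X i j *: b`_j | i < n].

Lemma row_combE X (i : 'I_n) : (row_comb X)`_i = \sum_j X i j *: b`_j.
Proof. by rewrite -tnth_nth tnth_mktuple. Qed.

Lemma sum_row_comb X (c : 'rV[K]_n) :
  \sum_i c 0 i *: (row_comb X)`_i = \sum_j (c *m X) 0 j *: b`_j.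
Proof.
under eq_bigr do rewrite row_combE scaler_sumr.
rewrite exchange_big; apply: eq_bigr => j _ /=.
by rewrite mxE scaler_suml; apply: eq_bigr => i _; rewrite scalerA.
Qed.

(** As [b] is free, [c] is a linear relation among the combined vectors exactly when [c *m X = 0];
    freeness thus says that the left kernel of [X] is trivial. *)
Lemma free_row_comb X : free b -> free (row_comb X) = (X \in unitmx).
Proof.
move=> /freeP b_free; rewrite -row_free_unit; apply/freeP/idP => [u_free|X_free].
  apply: inj_row_free => v vX0; apply/rowP => i; rewrite [RHS]mxE.
  apply: (u_free (v 0)); rewrite sum_row_comb vX0.
  by rewrite big1 // => j _; rewrite mxE scale0r.
move=> c c0 i; pose v : 'rV[K]_n := \row_i c i.
suff: v = 0 by move/rowP/(_ i); rewrite !mxE.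
apply: (row_free_inj X_free); rewrite mul0mx; apply/rowP => j; rewrite [RHS]mxE.
apply: (b_free ((v *m X) 0)); rewrite -sum_row_comb -[RHS]c0.
by apply: eq_bigr => k _; rewrite mxE.
Qed.

Lemma row_comb_coord (u : n.-tuple A) :
  basis_of {:A} b -> u = row_comb (\matrix_(i, j) coord b j u`_i).
Proof.
move=> b_basis; apply: eq_from_tnth => i; rewrite !(tnth_nth 0) row_combE.
rewrite {1}(coord_basis b_basis (memvf u`_i)).
by apply: eq_bigr => j _; rewrite mxE.
Qed.

End RowCombination.

(** In dimension [n], a free family of [n] vectors is a basis, so the basis condition reduces to
    invertibility of [X]. *)
Lemma natural_basis_row_comb (K : fieldType) (A : vectType K) (n : nat)
    (mul : {bilinear A -> A -> A}) (b : n.-tuple A) (X : 'M[K]_n) :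
  \dim {:A} = n -> basis_of {:A} b ->
  natural_basis mul (row_comb b X) <->
  X \in unitmx /\ forall i j : 'I_n, i != j ->
    mul (row_comb b X)`_i (row_comb b X)`_j = 0.
Proof.
move=> dimA b_basis; rewrite -(free_row_comb _ (basis_free b_basis)).
by rewrite /natural_basis basisEfree subvf size_tuple dimA leqnn !andbT.
Qed.

Section Evaluation.
Variables (K : fieldType) (A : vectType K) (n : nat).
Variables (mul : {bilinear A -> A -> A}) (e b : n.-tuple A).

Definition point_mx (x : 'I_(1 + n * n) -> K) : 'M[K]_n :=
  \matrix_(i, j) x (rshift 1 (mxvec_index i j)).

Lemma map_x_mx x : map_mx (meval x) (x_mx K n) = point_mx x.
Proof. by apply/matrixP => i j; rewrite !mxE mevalXU. Qed.

Lemma meval_p0 x :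
  (p0 K n).@[x] = 1 - x (lshift (n * n) ord0) * \det (point_mx x).
Proof. by rewrite /p0 mevalB meval1 mevalM mevalXU -det_map_mx map_x_mx. Qed.

Lemma meval_p_ijk x i j k :
  (p_ijk mul e b i j k).@[x] =
  coord e k (mul (row_comb b (point_mx x))`_i (row_comb b (point_mx x))`_j).
Proof.
pose X := point_mx x; pose G := gram_matrix (coord_form mul e k) b.
transitivity ((row i X *m G *m (row j X)^T) 0 0).
  (* Evaluation is a ring morphism, hence commutes with matrix products; it fixes the constant
     entries of [G]. *)
  have := congr1 (fun M : 'M[K]_1 => M 0 0) (map_mxM (meval x)
    (row i (x_mx K n) *m map_mx (@mpolyC _ K) G) (row j (x_mx K n))^T).
  rewrite mxE map_mxM -map_trmx !map_row map_x_mx => ->.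
  suff -> : map_mx (meval x) (map_mx (@mpolyC _ K) G) = G by [].
  by apply/matrixP => r s; rewrite !mxE mevalC.
(* The outer sum of the matrix product runs over the column factor, so the second argument of [mul]
   is expanded first. *)
rewrite !row_combE linear_sumr linear_sum mxE.
apply: eq_bigr => l _.
rewrite linear_sumlz linear_sum !mxE mulr_suml; apply: eq_bigr => m _.
by rewrite !mxE linearZlr !linearZ /= -mulrA [_ * x _]mulrC.
Qed.

End Evaluation.

Theorem proposition1 (K : fieldType) (A : vectType K) (n : nat)
    (mul : {bilinear A -> A -> A}) (mulC : forall x y : A, mul x y = mul y x)
    (dimA : \dim {:A} = n)
    (e b : n.-tuple A) (e_basis : basis_of {:A} e) (b_basis : basis_of {:A} b) :
  evolution_algebra mul <->
  exists x : 'I_(1 + n * n) -> K, zero_set (evolution_test_ideal mul e b) x.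
Proof.
have zeroP x : zero_set (evolution_test_ideal mul e b) x <->
    1 - x (lshift (n * n) ord0) * \det (point_mx x) = 0 /\
    forall i j : 'I_n, i != j ->
      mul (row_comb b (point_mx x))`_i (row_comb b (point_mx x))`_j = 0.
  rewrite zero_set_generated; split=> [x0|[p00 u0] s [->|[i [j [k [ij ->]]]]]].
  - split=> [|i j ij]; first by rewrite -meval_p0; apply: x0; left.
    (* A product is zero once all its coordinates in [e] are, and these are the values of the
       [p_ijk]. *)
    rewrite (coord_basis e_basis (memvf (mul _ _))) big1 // => k _.
    rewrite -meval_p_ijk x0 ?scale0r //; right.
    by exists i, j, k.
  - by rewrite meval_p0.
  - by rewrite meval_p_ijk u0 // linear0.
split=> [[u u_nat]|[x /zeroP[p00 u0]]]; last first.
  exists (row_comb b (point_mx x)).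
  apply/natural_basis_row_comb => //; split=> //.
  (* A zero determinant would give [p0] the value 1. *)
  rewrite unitmxE unitfE; apply/eqP => det0.
  by move/eqP: p00; rewrite det0 mulr0 subr0 oner_eq0.
(* A natural basis is a sequence of unspecified length; the dimension forces it to be [n]. *)
have size_u : size u == n.
  by rewrite -dimA (@size_basis _ _ _ _ (in_tuple u)) //; case: u_nat.
pose X : 'M[K]_n := \matrix_(i, j) coord b j u`_i.
have uE : u = row_comb b X := congr1 val (row_comb_coord (Tuple size_u) b_basis).
move: u_nat; rewrite uE => /natural_basis_row_comb[] // X_unit u0.
(* The witness takes the inverse of [\det X] for z, followed by the entries of [X] in the [mxvec]
   order that [point_mx] reads. *)
pose x (l : 'I_(1 + n * n)) : K :=
  row_mx (\det X)^-1%:M (mxvec X) 0 l.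
have xX : point_mx x = X.
  by apply/matrixP => i j; rewrite mxE /x row_mxEr mxvecE.
exists x; apply/zeroP; rewrite xX; split=> //.
rewrite /x row_mxEl mxE eqxx mulr1n mulVf ?subrr //.
by rewrite -unitfE -unitmxE.
Qed.
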